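(* Suppose $-\infty<A<B<\infty$. Then each $(s,t)\in(A,B)^2$ with $s\le t$ belongs to $\Omega(\mu)$ if $$(s+t-2A)^2<4(B-A)(s-A).$$ Furthermore, such $(s,t)$ does not belong to $\Omega(\mu)$ if the reverse strict inequality $(s+t-2A)^2>4(B-A)(s-A)$ holds.
   Context: Let $\mu$ be a $\sigma$-finite Borel measure on $\mathbb R$, $A=\inf\operatorname{supp}\mu$, $B=\sup\operatorname{supp}\mu$. Let $\Theta=\{\theta\in\mathbb R:\int e^{\theta x}\mu(dx)<\infty\}$, assumed nonempty and not a singleton, with interior $\Theta^\circ$; $\psi(\theta)=\log\int e^{\theta x}\mu(dx)$. An $m\times n$ margin is a pair $(\mathbf r,\mathbf c)\in\mathbb R^m\times\mathbb R^n$; $\mathcal T(\mathbf r,\mathbf c)$ is the set of real $m\times n$ matrices with row sums $\mathbf r$ and column sums $\mathbf c$. An MLE for $(\mathbf r,\mathbf c)$ is a maximizer of $\langle\mathbf r,\boldsymbol\alpha\rangle+\langle\mathbf c,\boldsymbol\beta\rangle-\sum_{i,j}\psi(\boldsymbol\alpha(i)+\boldsymbol\beta(j))$ over $(\boldsymbol\alpha,\boldsymbol\beta)\in\mathbb R^m\times\mathbb R^n$ with all $\boldsymbol\alpha(i)+\boldsymbol\beta(j)\in\Theta^\circ$. For $\delta>0$, $A_\delta=\max(A+\delta,-1/\delta)$, $B_\delta=\min(B-\delta,1/\delta)$; $(\mathbf r,\mathbf c)$ is $\delta$-tame if an MLE exists and $A_\delta\le\psi'(\boldsymbol\alpha(i)+\boldsymbol\beta(j))\le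 B_\delta$ for all $i,j$. $\Omega(\mu)$ is the set of $(s,t)\in(A,B)^2$ with $s\le t$ for which there is $\delta=\delta(\mu,s,t)>0$ such that, for all $m,n\ge1$, every $m\times n$ margin $(\mathbf r,\mathbf c)$ satisfying $\mathcal T(\mathbf r,\mathbf c)\cap(A,B)^{m\times n}\ne\emptyset$ and $s\le\mathbf r(i)/n\le t$, $s\le\mathbf c(j)/m\le t$ for all $i\in[m],j\in[n]$ is $\delta$-tame. *)

(* Defs.v *)
From HB Require Import structures.
From mathcomp Require Import all_boot all_order all_algebra.
From mathcomp Require Import all_classical all_reals all_analysis.

Set Implicit Arguments.
Unset Strict Implicit.
Unset Printing Implicit Defensive.

Import Order.TTheory GRing.Theory Num.Theory.
Import numFieldNormedType.Exports.

Local Open Scope classical_set_scope.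
Local Open Scope ring_scope.
Local Open Scope ereal_scope.

Section defs.
Context {R : realType}.
Variable mu : {measure set (measurableTypeR R) -> \bar R}.

Definition supp : set R :=
  [set x | forall U : set R, open U -> U x -> 0 < mu U].

Definition infsupp : \bar R := ereal_inf (EFin @` supp).

Definition supsupp : \bar R := ereal_sup (EFin @` supp).

Definition Theta : set R :=
  [set theta | \int[mu]_x (expR (theta * x))%:E < +oo].

(* Meaningful only on [Theta]: elsewhere [fine] sends +oo to 0. It is only ever
   evaluated, and differentiated, at points of the interior of [Theta]. *)
Definition psi (theta : R) : R :=
  ln (fine (\int[mu]_x (expR (theta * x))%:E)).

Definition Tmargin m n (r : 'rV[R]_m) (c : 'rV[R]_n) : set 'M[R]_(m, n) :=
  [set X | (forall i, (\sum_j X i j)%R = r ord0 i) /\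
           (forall j, (\sum_i X i j)%R = c ord0 j)].

Definition admissible m n (alpha : 'rV[R]_m) (beta : 'rV[R]_n) : Prop :=
  forall i j, Theta° (alpha ord0 i + beta ord0 j)%R.

Definition loglik m n (r : 'rV[R]_m) (c : 'rV[R]_n)
    (alpha : 'rV[R]_m) (beta : 'rV[R]_n) : R :=
  (\sum_i r ord0 i * alpha ord0 i + \sum_j c ord0 j * beta ord0 j
   - \sum_i \sum_j psi (alpha ord0 i + beta ord0 j))%R.

Definition is_MLE m n (r : 'rV[R]_m) (c : 'rV[R]_n)
    (alpha : 'rV[R]_m) (beta : 'rV[R]_n) : Prop :=
  admissible alpha beta /\
  forall (alpha' : 'rV[R]_m) (beta' : 'rV[R]_n), admissible alpha' beta' ->
    (loglik r c alpha' beta' <= loglik r c alpha beta)%R.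

Definition A_ (delta : R) : \bar R :=
  maxe (infsupp + delta%:E) (- delta^-1)%:E.

Definition B_ (delta : R) : \bar R :=
  mine (supsupp - delta%:E) (delta^-1)%:E.

Definition tame (delta : R) m n (r : 'rV[R]_m) (c : 'rV[R]_n) : Prop :=
  exists (alpha : 'rV[R]_m) (beta : 'rV[R]_n),
    is_MLE r c alpha beta /\
    forall i j, A_ delta <= (derive1 psi (alpha ord0 i + beta ord0 j)%R)%:E
                         <= B_ delta.

Definition Omega : set (R * R) :=
  [set st | [/\ infsupp < st.1%:E < supsupp,
                infsupp < st.2%:E < supsupp,
                (st.1 <= st.2)%R &
    exists delta : R, (0 < delta)%R /\
      forall m n : nat, (1 <= m)%N -> (1 <= n)%N ->
      forall (r : 'rV[R]_m) (c : 'rV[R]_n),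
        (exists X : 'M[R]_(m, n), Tmargin r c X /\
           forall i j, infsupp < (X i j)%:E < supsupp) ->
        (forall i, (st.1 <= r ord0 i / n%:R <= st.2)%R) ->
        (forall j, (st.1 <= c ord0 j / m%:R <= st.2)%R) ->
        tame delta r c]].

End defs.

(* Main.v *)
(* Write z = (psi' - A) / (B - A), so that z takes its values in ]0, 1[, and let
   s, t be rescaled accordingly: the condition becomes (s + t)^2 < 4 s. For sets
   I of rows and J of columns, the defect
     sum_(I x J) (1 - z) + sum_(I^c x J^c) z
   only depends on the margins of z.

   If (s + t)^2 < 4 s, the margin constraints force the defect to be at least a
   fixed fraction of the number m n of cells as soon as I and J are not too
   small. Now z_ij is a function of alpha_i + beta_j, and if some
   alpha_i + beta_j were very negative, there would be many well separated
   thresholds tau for which I = {alpha > tau} and J = {beta > - tau} are not too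
   small, while on average over tau the defect is o(m n). So the alpha_i + beta_j
   are bounded independently of m and n, from above as well by the reflection
   z -> 1 - z. The MLE itself exists because the likelihood is coercive modulo
   the translations (alpha + a, beta - a).

   If (s + t)^2 > 4 s, some rational a in ]0, 1[ satisfies
   a^2 - (s + t) a + s < 0, and then a symmetric 2 x 2 block matrix with blocks
   of relative sizes a, 1 - a and entries 1 - e, y, e has margins in [s, t] and
   defect e times the number of cells of the diagonal blocks, for all small e;
   an MLE with the same margins cannot have all its entries in
   [d, 1 - d] with d > e. *)
Require Import Defs.
From HB Require Import structures.
From mathcomp Require Import all_boot all_order all_algebra.
From mathcomp Require Import all_classical all_reals all_analysis.
From mathcomp Require Import measurable_realfun ring lra.
Import Order.TTheory GRing.Theory Num.Theory.
Import numFieldNormedType.Exports.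
Local Open Scope classical_set_scope.
Local Open Scope ring_scope.

(** * The defect of a matrix *)

Section Defect.
Context {R : realFieldType}.
Implicit Types (s t p q k : R).

(** Rows and columns are selected by weights rather than by sets, so that the identities below are
    polynomial; the weights are eventually taken to be 0-1 valued. *)
Definition defect m n (x : 'I_m -> R) (y : 'I_n -> R) (z : 'I_m -> 'I_n -> R) : R :=
  \sum_i \sum_j (x i * y j * (1 - z i j) + (1 - x i) * (1 - y j) * z i j).

Lemma defectC m n (x : 'I_m -> R) (y : 'I_n -> R) (z : 'I_m -> 'I_n -> R) :
  defect m n x y z = defect n m y x (fun j i => z i j).
Proof.
rewrite /defect exchange_big; apply: eq_bigr => j _; apply: eq_bigr => i _.
by rewrite (mulrC (x i)) (mulrC (1 - x i)).
Qed.

(** The products of three factors cancel: each cell equals [x y - x z + (1 - y) z]. Hence [z] enters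
    only through its row and column sums. *)
Lemma defectE m n (x : 'I_m -> R) (y : 'I_n -> R) (z : 'I_m -> 'I_n -> R) :
  defect m n x y z = (\sum_i x i) * (\sum_j y j) - \sum_i x i * (\sum_j z i j)
    + \sum_j (1 - y j) * (\sum_i z i j).
Proof.
under [\sum_j (1 - y j) * _]eq_bigr do rewrite mulr_sumr.
rewrite [\sum_j \sum_i _]exchange_big /= mulr_suml -sumrB -big_split/=.
apply: eq_bigr => i _; rewrite !mulr_sumr -sumrB -big_split/=.
by apply: eq_bigr => j _; ring.
Qed.

Lemma defect_ge m n (x : 'I_m -> R) (y : 'I_n -> R) (z : 'I_m -> 'I_n -> R) s t :
  (forall i, 0 <= x i) -> (forall j, y j <= 1) ->
  (forall i, \sum_j z i j <= t * n%:R) -> (forall j, s * m%:R <= \sum_i z i j) ->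
  (\sum_i x i) * (\sum_j y j) - (\sum_i x i) * (t * n%:R)
    + (n%:R - \sum_j y j) * (s * m%:R) <= defect m n x y z.
Proof.
move=> x0 y1 zt zs; rewrite defectE; apply: lerD; first apply: lerB => //.
  by rewrite mulr_suml; apply: ler_sum => i _; exact: ler_wpM2l.
have -> : n%:R - \sum_j y j = \sum_j (1 - y j).
  by rewrite sumrB sumr_const card_ord.
by rewrite mulr_suml; apply: ler_sum => j _; apply: ler_wpM2l; rewrite ?subr_ge0.
Qed.

(* For fixed [p] the right-hand side is affine in [q], hence bounded below by its
   values at [q = p], where completing the square applies, and at [q = 1]. *)
Lemma defect_density_ge s t p q k eta : 0 < k ->
  k <= s - ((s + t) / 2) ^+ 2 -> k <= (1 - t) * eta -> eta <= p -> p <= q ->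
  q <= 1 -> t < 1 -> k <= p * q - p * t + (1 - q) * s.
Proof.
move=> k0 ks kt ep pq q1 t1.
have h1 : k <= p ^+ 2 - p * (s + t) + s.
  have := sqr_ge0 (p - (s + t) / 2); nra.
have h2 : k <= (1 - t) * p by nra.
have [p1|p1] := ltP p 1; last first.
  have -> : q = 1 by lra.
  have -> : p = 1 by lra.
  nra.
rewrite -(ler_pM2l (x := 1 - p)); last by lra.
nra.
Qed.

(** Applying [defect_ge] to [z] and to its transpose gives two estimates in the densities [q] of
    rows and [p] of columns. [defect_density_ge] needs the smaller density in first position, which
    decides between the two. *)
Lemma defect_lower_bound m n (x : 'I_m -> R) (y : 'I_n -> R)
    (z : 'I_m -> 'I_n -> R) s t k eta :
  (0 < m)%N -> (0 < n)%N ->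
  (forall i, 0 <= x i <= 1) -> (forall j, 0 <= y j <= 1) ->
  (forall i, s * n%:R <= \sum_j z i j <= t * n%:R) ->
  (forall j, s * m%:R <= \sum_i z i j <= t * m%:R) ->
  t < 1 -> 0 < k -> k <= s - ((s + t) / 2) ^+ 2 -> k <= (1 - t) * eta ->
  eta * m%:R <= \sum_i x i -> eta * n%:R <= \sum_j y j ->
  k * (m%:R * n%:R) <= defect m n x y z.
Proof.
move=> m0 n0 x01 y01 zr zc t1 k0 ks ke ex ey.
have mR : 0 < m%:R :> R by rewrite ltr0n.
have nR : 0 < n%:R :> R by rewrite ltr0n.
have sx : \sum_i x i <= m%:R.
  rewrite -[m in leRHS]card_ord -sum1_card natr_sum; apply: ler_sum => i _.
  by case/andP: (x01 i).
have sy : \sum_j y j <= n%:R.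
  rewrite -[n in leRHS]card_ord -sum1_card natr_sum; apply: ler_sum => j _.
  by case/andP: (y01 j).
have D1 : (\sum_i x i) * (\sum_j y j) - (\sum_i x i) * (t * n%:R)
    + (n%:R - \sum_j y j) * (s * m%:R) <= defect m n x y z.
  apply: defect_ge => [i|j|i|j]; first by case/andP: (x01 i).
  - by case/andP: (y01 j).
  - by case/andP: (zr i).
  - by case/andP: (zc j).
have D2 : (\sum_j y j) * (\sum_i x i) - (\sum_j y j) * (t * m%:R)
    + (m%:R - \sum_i x i) * (s * n%:R) <= defect m n x y z.
  rewrite defectC; apply: defect_ge => [j|i|j|i]; first by case/andP: (y01 j).
  - by case/andP: (x01 i).
  - by case/andP: (zc j).
  - by case/andP: (zr i).
set X := \sum_i x i in ex sx D1 D2 *; set Y := \sum_j y j in ey sy D1 D2 *.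
have qE : X = X / m%:R * m%:R by rewrite divfK// gt_eqF.
have pE : Y = Y / n%:R * n%:R by rewrite divfK// gt_eqF.
set q := X / m%:R in qE; set p := Y / n%:R in pE.
have eq : eta <= q by rewrite ler_pdivlMr.
have ep : eta <= p by rewrite ler_pdivlMr.
have q1 : q <= 1 by rewrite ler_pdivrMr// mul1r.
have p1 : p <= 1 by rewrite ler_pdivrMr// mul1r.
have mn0 : 0 < m%:R * n%:R :> R by exact: mulr_gt0.
have [pq|qp] := lerP p q.
- have h := defect_density_ge _ _ _ _ _ _ k0 ks ke ep pq q1 t1.
  apply: le_trans D2; rewrite qE pE.
  have -> : p * n%:R * (q * m%:R) - p * n%:R * (t * m%:R) +
    (m%:R - q * m%:R) * (s * n%:R) = (p * q - p * t + (1 - q) * s) * (m%:R * n%:R).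
    by ring.
  by rewrite ler_pM2r.
- have h := defect_density_ge _ _ _ _ _ _ k0 ks ke eq (ltW qp) p1 t1.
  apply: le_trans D1; rewrite qE pE.
  have -> : q * m%:R * (p * n%:R) - q * m%:R * (t * n%:R) +
    (n%:R - p * n%:R) * (s * m%:R) = (q * p - q * t + (1 - p) * s) * (m%:R * n%:R).
    by ring.
  by rewrite ler_pM2r.
Qed.

End Defect.

(** * Uniform bounds from averaging over thresholds *)

Section Thresholds.
Context {R : realType}.
Implicit Types (phi : R -> R) (s t : R).

Lemma sum_le1_unique N (F : 'I_N -> R) : (forall k, F k <= 1) ->
  (forall k l, F k != 0 -> F l != 0 -> k = l) -> \sum_k F k <= 1.
Proof.
move=> F1 Fu; have [k Fk|F0] := pickP (fun k => F k != 0).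
  rewrite (bigD1 k)//= big1 ?addr0// => l lk; apply/eqP.
  by apply: contraNT lk => Fl; rewrite (Fu _ _ Fl Fk).
by rewrite big1// => k _; apply/eqP; move/negbT: (F0 k); rewrite negbK.
Qed.

(* If [K <= `|a + b|] every threshold contributes at most [e]; otherwise at most
   one threshold contributes, since they are [K] apart. *)
Lemma threshold_cell (a b c K e z : R) N : 0 < K -> 0 <= e -> 0 <= z <= 1 ->
  (K <= a + b -> 1 - e <= z) -> (a + b <= - K -> z <= e) ->
  let x (k : 'I_N) : R := (c + K * k%:R < a)%R%:R in
  let y (k : 'I_N) : R := (- (c + K * k%:R) < b)%R%:R in
  is_true (\sum_k (x k * y k * (1 - z) + (1 - x k) * (1 - y k) * z) <= N%:R * e + 1).
Proof.
move=> K0 e0 /andP[z0 z1] zhi zlo x y.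
have xy k : x k * y k * (1 - z) + (1 - x k) * (1 - y k) * z =
  if (c + K * k%:R < a) && (- (c + K * k%:R) < b) then 1 - z else
  if (a <= c + K * k%:R) && (b <= - (c + K * k%:R)) then z else 0.
  rewrite /x /y; case: ltP => _; case: ltP => _ /=; ring.
have small : (forall k, x k * y k * (1 - z) + (1 - x k) * (1 - y k) * z <= e) ->
    \sum_k (x k * y k * (1 - z) + (1 - x k) * (1 - y k) * z) <= N%:R * e + 1.
  move=> le; apply: (@le_trans _ _ (\sum_(k < N) e)); first by apply: ler_sum.
  by rewrite sumr_const card_ord mulr_natl; lra.
have [hi|hi] := leP K (a + b).
  have := zhi hi => ze; apply: small => k; rewrite xy.
  by case: ifP => [_|_]; [lra|case: ifP => [/andP[]|//]; lra].
have [lo|lo] := leP (a + b) (- K).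
  have := zlo lo => ze; apply: small => k; rewrite xy.
  by case: ifP => [/andP[]|_]; [lra|case: ifP => // _; lra].
apply: (@le_trans _ _ 1); last first.
  have : 0 <= N%:R * e by rewrite mulr_ge0.
  lra.
apply: sum_le1_unique => [k|k l]; rewrite !xy.
  by case: ifP => _; [lra|case: ifP => _; lra].
have key u v : - K < u - v -> u - v < K -> u = c + K * k%:R -> v = c + K * l%:R -> k = l.
  move=> h1 h2 ue ve; apply/val_inj; apply/eqP; rewrite eqn_leq.
  have h3 : K * (k%:R - l%:R) < K * 1 by lra.
  have h4 : K * (l%:R - k%:R) < K * 1 by lra.
  move: h3 h4; rewrite !ltr_pM2l// !ltrBlDl => h3 h4.
  by rewrite -ltnS -(ltr_nat R) -[X in _ && X]ltnS -[X in _ && X](ltr_nat R) -!natr1 h3 h4.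
move=> kn0 ln0; apply: (key (c + K * k%:R) (c + K * l%:R)) => //; move: kn0 ln0;
  do 2 (case: ifP => [/andP[? ?] _|_]; [|case: ifP => [/andP[? ?] _|]; [|by rewrite eqxx]]); lra.
Qed.

(** Each of [N] thresholds has defect at least [kap * (m * n)], whereas [threshold_cell] bounds
    their total by [m * n * (N * e + 1)]. With [e <= kap / 2] and [N * (kap / 2) > 1] this is a
    contradiction, and [N] does not depend on [m] and [n]. *)
Lemma additive_lower_bound phi s t :
  (forall e, 0 < e -> exists K, forall x : R, x <= - K -> phi x <= e) ->
  (forall e, 0 < e -> exists K, forall x, K <= x -> 1 - e <= phi x) ->
  (forall x, 0 <= phi x <= 1) -> 0 < s -> t < 1 -> (s + t) ^+ 2 < 4 * s ->
  exists M, forall m n (a : 'I_m -> R) (b : 'I_n -> R),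
    (forall i, s * n%:R <= \sum_j phi (a i + b j) <= t * n%:R) ->
    (forall j, s * m%:R <= \sum_i phi (a i + b j) <= t * m%:R) ->
    forall i j, - M <= a i + b j.
Proof.
move=> lim0 lim1 phi01 s0 t1 st.
(* The two terms are the constraints on [k] in [defect_lower_bound] for densities at least
   [eta = s / 2]; the first is positive because [(s + t) ^+ 2 < 4 * s]. *)
pose kap := Num.min (s - ((s + t) / 2) ^+ 2) ((1 - t) * (s / 2)).
have kap0 : 0 < kap by rewrite lt_min; apply/andP; split; nra.
have ks : kap <= s - ((s + t) / 2) ^+ 2 by rewrite ge_min lexx.
have ke : kap <= (1 - t) * (s / 2) by rewrite ge_min lexx orbT.
pose e := Num.min (kap / 2) (s / 2).
have e0 : 0 < e by rewrite lt_min; apply/andP; split; lra.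
have ek : e <= kap / 2 by rewrite ge_min lexx.
have es : e <= s / 2 by rewrite ge_min lexx orbT.
have [K0 hK0] := lim0 _ e0; have [K1 hK1] := lim1 _ e0.
pose K := Num.max 1 (Num.max K0 K1).
have Kpos : 0 < K by rewrite lt_max ltr01.
have KK0 : K0 <= K by rewrite !le_max lexx orbT.
have KK1 : K1 <= K by rewrite !le_max lexx !orbT.
have plo x : x <= - K -> phi x <= e by move=> xK; apply: hK0; lra.
have phi1 x : K <= x -> 1 - e <= phi x by move=> xK; apply: hK1; lra.
pose N := (Num.truncn (2 / kap)).+1.
have Nk : 1 < N%:R * (kap / 2).
  have : 2 / kap < N%:R by exact: truncnS_gt.
  rewrite ltr_pdivrMr//; lra.
(* A sum below [- K (N + 2)] leaves room for [N] thresholds spaced by [K], all at least [K] above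
   [a i0] and at least [K] below [- b j0]. *)
exists (K * (N%:R + 2)) => m n a b hr hc i0 j0.
rewrite leNgt; apply/negP => hM.
have m0 : (0 < m)%N by exact: leq_ltn_trans (ltn_ord i0).
have n0 : (0 < n)%N by exact: leq_ltn_trans (ltn_ord j0).
pose c := a i0 + K.
pose x (k : 'I_N) i : R := (c + K * k%:R < a i)%R%:R.
pose y (k : 'I_N) j : R := (- (c + K * k%:R) < b j)%R%:R.
have up : \sum_k defect m n (x k) (y k) (fun i j => phi (a i + b j)) <=
    (m%:R * n%:R) * (N%:R * e + 1).
  rewrite /defect exchange_big/=.
  have -> : m%:R * n%:R * (N%:R * e + 1) = \sum_(i < m) \sum_(j < n) (N%:R * e + 1).
    rewrite !sumr_const !card_ord !mulr_natl -[RHS]mulr_natl -[in RHS]mulr_natl; ring.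
  apply: ler_sum => i _; rewrite exchange_big/=; apply: ler_sum => j _.
  by apply: threshold_cell => //; [exact: ltW|exact: phi1|exact: plo].
have lo k : kap * (m%:R * n%:R) <= defect m n (x k) (y k) (fun i j => phi (a i + b j)).
  have k0 : 0 <= k%:R :> R by [].
  have kN : k%:R + 1 <= N%:R :> R by rewrite natr1 ler_nat.
  have kK0 : 0 <= K * k%:R by rewrite mulr_ge0// ltW.
  have kKN : K * (k%:R + 1) <= K * N%:R by rewrite ler_pM2l.
  apply: (@defect_lower_bound _ m n _ _ _ s t kap (s / 2)) => //.
  - by move=> i; rewrite ler0n lern1 leq_b1.
  - by move=> j; rewrite ler0n lern1 leq_b1.
  (* In column [j0] the rows outside the threshold set have [phi <= e <= s / 2], while the average
     is at least [s]; so the set holds at least a fraction [s / 2] of the rows. Row [i0] does the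
     same for columns. *)
  - have /andP[hs _] := hc j0.
    suff : \sum_i phi (a i + b j0) <= \sum_i (x k i + s / 2).
      rewrite big_split/= sumr_const card_ord -mulr_natl; lra.
    apply: ler_sum => i _; rewrite /x.
    case: ltP => [_|ai] /=; first by have /andP[] := phi01 (a i + b j0); lra.
    rewrite add0r; apply: le_trans es; apply: plo; rewrite /c in ai; nra.
  - have /andP[hs _] := hr i0.
    suff : \sum_j phi (a i0 + b j) <= \sum_j (y k j + s / 2).
      rewrite big_split/= sumr_const card_ord -mulr_natl; lra.
    apply: ler_sum => j _; rewrite /y.
    case: ltP => [_|bj] /=; first by have /andP[] := phi01 (a i0 + b j); lra.
    rewrite add0r; apply: le_trans es; apply: plo; rewrite /c in bj; lra.
have mn0 : 0 < m%:R * n%:R :> R by rewrite mulr_gt0// ltr0n.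
have : N%:R * kap <= N%:R * e + 1.
  rewrite -(ler_pM2l mn0); apply: le_trans up.
  have -> : m%:R * n%:R * (N%:R * kap) = \sum_(k < N) kap * (m%:R * n%:R).
    by rewrite sumr_const card_ord -mulr_natl; ring.
  by apply: ler_sum => k _; exact: lo.
have : N%:R * e <= N%:R * (kap / 2) by rewrite ler_pM2l// ltr0n.
lra.
Qed.

(** Upper bounds are lower bounds for the reflected function [1 - phi (- x)], whose margins lie
    between [1 - t] and [1 - s]. The condition is invariant: [(2 - s - t) ^+ 2 < 4 * (1 - t)]
    amounts to [(s + t) ^+ 2 < 4 * s]. *)
Lemma additive_bound phi s t :
  (forall e, 0 < e -> exists K, forall x : R, x <= - K -> phi x <= e) ->
  (forall e, 0 < e -> exists K, forall x, K <= x -> 1 - e <= phi x) ->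
  (forall x, 0 <= phi x <= 1) -> 0 < s -> t < 1 -> (s + t) ^+ 2 < 4 * s ->
  exists M, forall m n (a : 'I_m -> R) (b : 'I_n -> R),
    (forall i, s * n%:R <= \sum_j phi (a i + b j) <= t * n%:R) ->
    (forall j, s * m%:R <= \sum_i phi (a i + b j) <= t * m%:R) ->
    forall i j, `|a i + b j| <= M.
Proof.
move=> lim0 lim1 phi01 s0 t1 st.
have [M1 hM1] := additive_lower_bound _ _ _ lim0 lim1 phi01 s0 t1 st.
have [M2 hM2] : exists M, forall m n (a : 'I_m -> R) (b : 'I_n -> R),
    (forall i, (1 - t) * n%:R <= \sum_j (1 - phi (- (a i + b j))) <= (1 - s) * n%:R) ->
    (forall j, (1 - t) * m%:R <= \sum_i (1 - phi (- (a i + b j))) <= (1 - s) * m%:R) ->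
    forall i j, - M <= a i + b j.
  apply: (additive_lower_bound (fun x => 1 - phi (- x))); [| | |lra|lra|nra].
  - move=> e /lim1[K hK]; exists K => x xK.
    have := hK (- x); lra.
  - move=> e /lim0[K hK]; exists K => x xK.
    have := hK (- x); lra.
  - by move=> x; have := phi01 (- x); lra.
exists (Num.max M1 M2) => m n a b hr hc i j.
rewrite ler_norml le_max lerNl le_max.
rewrite [X in X || _](_ : _ = true) /=; last by have := hM1 m n a b hr hc i j; lra.
suff -> : a i + b j <= M2 by rewrite orbT.
have := hM2 m n (fun i => - a i) (fun j => - b j) _ _ i j.
rewrite -opprD lerN2; apply.
- move=> k; rewrite sumrB sumr_const card_ord.
  under eq_bigr do rewrite -opprD opprK.
  have := hr k; lra.
- move=> k; rewrite sumrB sumr_const card_ord.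
  under eq_bigr do rewrite -opprD opprK.
  have := hc k; lra.
Qed.

End Thresholds.

(** * Tilted means of a compactly supported measure *)

Section Support.
Context {R : realType} (mu : {measure set (measurableTypeR R) -> \bar R}).

(** A point outside the support has a null open neighbourhood, hence lies in a null interval with
    rational endpoints. There are countably many of these; [F] enumerates them, with [set0] for all
    other codes. *)
Lemma negligible_supp_compl : mu.-negligible (~` supp mu).
Proof.
pose J (q r : rat) : set (measurableTypeR R) := `]ratr q, ratr r[%classic.
pose F (k : nat) : set (measurableTypeR R) := if unpickle k is Some (q, r) then
  if mu (J q r) == 0%E then J q r else set0 else set0.
have : mu.-negligible (\bigcup_k F k).
  apply: negligible_bigcup => k; rewrite /F.
  case: (unpickle k) => [[q r]|]; last exact: negligible_set0.
  case: ifP => [/eqP h|_]; last exact: negligible_set0.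
  apply: (negligibleP _ _).2 h; exact: measurable_itv.
apply: negligibleS.
move=> x; rewrite /supp/= => /existsNP[U /not_implyP[oU /not_implyP[Ux /negP]]].
rewrite -leNgt measure_le0 => /eqP U0.
have [e /= e0 xeU] : nbhs_ball x U by apply/nbhs_ballP; exact: open_nbhs_nbhs.
have [q] : exists q, ratr q \in `]x - e, x[.
  by apply: rat_in_itvoo; rewrite ltrBlDr ltrDl.
rewrite in_itv/= => /andP[q1 q2].
have [r] : exists q, ratr q \in `]x, x + e[.
  by apply: rat_in_itvoo; rewrite ltrDl.
rewrite in_itv/= => /andP[r1 r2].
exists (pickle (q, r)); [exact: I|rewrite /F pickleK /J].
rewrite ifT; first by rewrite /= in_itv/= q2 r1.
rewrite -measure_le0 -U0; apply: le_measure; rewrite ?inE//=.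
  exact: open_measurable.
move=> y /=; rewrite in_itv/= => /andP[qy yr]; apply: xeU.
rewrite /ball/= ltr_norml; apply/andP; split; lra.
Qed.

End Support.

(** * Exponential moments over a compact interval *)

Section CompactMeasure.
Context {R : realType} (mu : {measure set (measurableTypeR R) -> \bar R}) (A B : R).
Local Notation D := (`[A, B]%classic : set (measurableTypeR R)).
Lemma itvcc_norm_le x : D x -> `|x| <= `|A| + `|B|.
Proof.
rewrite /= in_itv/= => /andP[Ax xB]; rewrite ler_norml.
have := ler_norm (- A); have := ler_norm B; have := normr_ge0 A.
have := normr_ge0 B; rewrite normrN => *; apply/andP; split; lra.
Qed.

Hypothesis muD : (mu D < +oo)%E.

Lemma continuous_integrable (f : R -> R) : continuous f ->
  mu.-integrable D (EFin \o f).
Proof.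
move=> cf; apply: measurable_bounded_integrable => //.
  apply: measurable_funTS; exact: continuous_measurable_fun.
have : bounded_set (f @` `[A, B]).
  apply: compact_bounded; apply: continuous_compact; last exact: segment_compact.
  exact: continuous_subspaceT.
by rewrite /bounded_set /bounded_near => -[M [Mr h]]; exists M; split => // y /h hy x Dx;
  apply: hy; exists x.
Qed.

(** Comparison with the simple function [c * \1_E - d]. Taking [d = 0] gives positivity; a small [d]
    absorbs the part of the integrand that may be negative. *)
Lemma Rintegral_ge_indic (f : R -> R) E c d : continuous f -> measurable E ->
  E `<=` D -> (forall x, D x -> - d <= f x) -> (forall x, E x -> c - d <= f x) ->
  c * fine (mu E) - d * fine (mu D) <= \int[mu]_(x in D) f x.
Proof.
move=> cf mE ED fd fE.
have mD : measurable D by exact: measurable_itv.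
have i1 : mu.-integrable D (EFin \o (\1_E : _ -> R)).
  apply: measurable_bounded_integrable => //.
  exists 1; split => // y y1 x _ /=; apply: le_trans (ltW y1).
  by rewrite indicE normr_nat lern1 leq_b1.
have i2 : mu.-integrable D (EFin \o (fun x => c * (\1_E x : R))).
  exact: (integrableZl mD c i1).
have i3 : mu.-integrable D (EFin \o (fun=> d)).
  by apply: continuous_integrable; exact: cst_continuous.
have <- : \int[mu]_(x in D) (c * \1_E x - d) = c * fine (mu E) - d * fine (mu D).
  rewrite RintegralB// RintegralZl// Rintegral_cst//.
  by rewrite /Rintegral integral_indic// setIidl.
apply: le_Rintegral => //.
- exact: (integrableB mD i2 i3).
- exact: continuous_integrable.
- move=> x Dx; rewrite indicE; case: (boolP (x \in E)) => [/set_mem/fE|_] /=.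
    by rewrite mulr1.
  by rewrite mulr0 sub0r; exact: fd.
Qed.

(** [expmoment 0] is the Laplace transform of the measure on [D] and [expmoment 1] its derivative;
    their quotient is the mean of the exponentially tilted measure. *)
Definition expmoment (k : nat) (theta : R) : R :=
  \int[mu]_(x in D) (x ^+ k * expR (theta * x)).

Lemma continuous_exp_affine (theta a b : R) :
  continuous (fun x => (a * x + b) * expR (theta * x)).
Proof.
move=> x; apply: cvgM.
  by apply: cvgD; [apply: cvgM; [exact: cvg_cst|exact: cvg_id]|exact: cvg_cst].
apply: (@continuous_comp _ _ _ ( *%R theta) expR); last exact: continuous_expR.
by apply: cvgM; [exact: cvg_cst|exact: cvg_id].
Qed.

Lemma Rintegral_exp_affine theta (a b : R) :
  \int[mu]_(x in D) ((a * x + b) * expR (theta * x)) =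
  a * expmoment 1 theta + b * expmoment 0 theta.
Proof.
have i1 : mu.-integrable D (EFin \o (fun x => x ^+ 1 * expR (theta * x))).
  rewrite [X in EFin \o X](_ : _ = fun x => (1 * x + 0) * expR (theta * x)).
    exact/continuous_integrable/continuous_exp_affine.
  by apply/funext => x; rewrite mul1r addr0.
have i0 : mu.-integrable D (EFin \o (fun x => x ^+ 0 * expR (theta * x))).
  rewrite [X in EFin \o X](_ : _ = fun x => (0 * x + 1) * expR (theta * x)).
    exact/continuous_integrable/continuous_exp_affine.
  by apply/funext => x; rewrite mul0r add0r.
have mD : measurable D by exact: measurable_itv.
rewrite /expmoment -!RintegralZl// -RintegralD//.
- by apply: eq_Rintegral => x _; rewrite expr1 expr0; ring.
- exact: (integrableZl mD a i1).
- exact: (integrableZl mD b i0).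
Qed.

Lemma is_derive_expmoment0 (theta : R) : is_derive theta 1 (expmoment 0) (expmoment 1 theta).
Proof.
pose C : R := `|A| + `|B|.
have C0 : 0 <= C by rewrite addr_ge0.
pose f (l x : R) := x ^+ 0 * expR (l * x).
have df (l x : R) : is_derive l 1 (f ^~ x) (x * expR (l * x)).
  have -> : f ^~ x = fun l => expR (l * x).
    by apply/funext => y; rewrite /f expr0 mul1r.
  have h1 : is_derive l 1 (fun y : R => y * x) x.
    have -> : (fun y : R => y * x) = id * cst x by [].
    by apply: is_derive_eq; rewrite /GRing.scale/= mulr0 add0r mulr1.
  by rewrite mulrC; exact: (@is_derive1_comp _ expR (fun y : R => y * x) l _ _ _ h1).
pose I := `]theta - 1, theta + 1[%classic : set R.
have Ith : I theta by rewrite /I/= in_itv/= ltrBlDr !ltrDl ltr01.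
(* A constant dominates the derivative [x * expR (l * x)] for all [l] within 1 of [theta], since |x|
   is at most [C] on [D]. *)
pose G (x : R) := C * expR ((`|theta| + 1) * C).
have intf l : I l -> mu.-integrable D (EFin \o f l).
  move=> _; rewrite [X in EFin \o X](_ : _ = fun x => (0 * x + 1) * expR (l * x)).
    exact/continuous_integrable/continuous_exp_affine.
  by apply/funext => x; rewrite mul0r add0r.
have derf l x : I l -> D x -> derivable (f ^~ x) l 1 by move=> _ _; exact: ex_derive.
have G0 x : 0 <= G x by rewrite mulr_ge0// expR_ge0.
have iG : mu.-integrable D (EFin \o G).
  by apply: continuous_integrable; exact: cst_continuous.
have Gub l x : I l -> D x -> `|partial1of2 f l x| <= G x.
  move=> Il Dx; rewrite partial1of2E (@derive_val _ _ _ _ _ _ _ (df l x)).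
  rewrite normrM (ger0_norm (expR_ge0 _)) /G ler_pM ?expR_ge0//; first exact: itvcc_norm_le.
  rewrite ler_expR (le_trans (ler_norm _))// normrM ler_pM//; last exact: itvcc_norm_le.
  move: Il; rewrite /I/= in_itv/= => /andP[l1 l2].
  rewrite ler_norml; have := ler_norm theta; have := ler_norm (- theta).
  rewrite normrN; lra.
have mD : measurable D by exact: measurable_itv.
have := derivable_under_integral mD Ith intf derf G0 iG Gub => dF.
have := differentiation_under_integral mD Ith intf derf G0 iG Gub.
rewrite derive1E => DF; apply: DeriveDef; first exact: dF.
rewrite [LHS]DF; apply: eq_Rintegral => x _.
by rewrite partial1of2E (@derive_val _ _ _ _ _ _ _ (df theta x)) expr1.
Qed.

Local Notation N k theta := (expmoment k theta).
Implicit Types (E : set (measurableTypeR R)) (sg b eta theta M : R).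

Lemma norm_mul_itvcc_le theta M x : `|theta| <= M -> D x ->
  `|theta * x| <= M * (`|A| + `|B|).
Proof. by move=> tM /itvcc_norm_le xC; rewrite normrM ler_pM. Qed.

(** The sign [sg] lets one proof serve both endpoints: [sg = 1] with [b = A], and [sg = -1] with
    [b = B]. The tilting weight lies between [expR (- C)] and [expR C], so the set [E] alone keeps
    the mean away from [b]. *)
Lemma tilted_mean_gap sg b eta E M : measurable E -> E `<=` D ->
  0 < fine (mu E) -> 0 < eta -> (forall x, D x -> 0 <= sg * (x - b)) ->
  (forall x, E x -> eta <= sg * (x - b)) ->
  exists2 d, 0 < d & forall theta, `|theta| <= M ->
    d * N 0 theta <= sg * (N 1 theta - b * N 0 theta).
Proof.
move=> mE ED muE eta0 sD sE.
have mD : measurable D by exact: measurable_itv.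
pose C := M * (`|A| + `|B|).
have muED : fine (mu E) <= fine (mu D).
  apply: fine_le; last by apply: le_measure; rewrite ?inE.
  - rewrite ge0_fin_numE// (le_lt_trans _ muD)// le_measure ?inE//.
  - by rewrite ge0_fin_numE.
have muD0 : 0 < fine (mu D) by exact: lt_le_trans muED.
(* The lower bound of the integral over [E], divided by the upper bound of [N 0 theta]. *)
exists (eta * expR (- C) * fine (mu E) / (expR C * fine (mu D))).
  by rewrite divr_gt0 ?mulr_gt0 ?expR_gt0.
move=> theta tM.
have bnd x : D x -> - C <= theta * x <= C.
  by move=> Dx; rewrite -ler_norml; exact: norm_mul_itvcc_le.
have NC : N 0 theta <= expR C * fine (mu D).
  rewrite -(Rintegral_cst mu mD); apply: le_Rintegral => //.
  - rewrite [X in EFin \o X](_ : _ = fun x => (0 * x + 1) * expR (theta * x)).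
      exact/continuous_integrable/continuous_exp_affine.
    by apply/funext => x; rewrite mul0r add0r.
  - by apply: continuous_integrable => //; exact: cst_continuous.
  - by move=> x /bnd/andP[_]; rewrite expr0 mul1r ler_expR.
apply: (@le_trans _ _ (eta * expR (- C) * fine (mu E))).
  rewrite mulrC mulrCA ger_pMr ?mulr_gt0 ?expR_gt0//.
  by rewrite ler_pdivrMr ?mul1r// mulr_gt0// expR_gt0.
have -> : sg * (N 1 theta - b * N 0 theta) =
    \int[mu]_(x in D) ((sg * x + - (sg * b)) * expR (theta * x)).
  by rewrite Rintegral_exp_affine//; ring.
rewrite -[leLHS]subr0 -(mul0r (fine (mu D))).
apply: Rintegral_ge_indic => //; first exact: continuous_exp_affine.
  by move=> x /sD; rewrite oppr0 -mulrBr => sx; rewrite mulr_ge0// expR_ge0.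
move=> x Ex; rewrite subr0 -mulrBr ler_pM ?expR_ge0//; [exact: ltW|exact: sE|].
by rewrite ler_expR; case/andP: (bnd _ (ED _ Ex)).
Qed.

(** For negative [y], the inequality [1 + v <= expR v] at [v = - (u * y)] gives
    [expR (u * y) * (1 - u * y) <= 1]. The negative part of a tilted integrand is thus at most
    [u^-1]. *)
Lemma mulr_expR_ge (u y : R) : 0 < u -> - u^-1 <= y * expR (u * y).
Proof.
move=> u0; have [y0|y0] := leP 0 y.
  rewrite (@le_trans _ _ 0) ?mulr_ge0 ?expR_ge0// oppr_le0 invr_ge0; exact: ltW.
have : expR (u * y) * (1 + - (u * y)) <= expR (u * y) * expR (- (u * y)).
  by rewrite ler_pM2l ?expR_gt0// expR_ge1Dx.
rewrite -expRD subrr expR0 => h.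
have e0 := expR_gt0 (u * y).
rewrite -(ler_pM2l u0) mulrN divff ?gt_eqF//; nra.
Qed.

(** Multiplying by the positive factor [w] turns the integrand into [v * expR (u * v)] with
    [v = sg * (x - b)]. It is at least [- u^-1] on [D] and at least [eta] on [E], so the mass of [E]
    wins once [u] is large. *)
Lemma tilted_mean_limit sg b eta E : sg * sg = 1 -> measurable E -> E `<=` D ->
  0 < fine (mu E) -> 0 < eta -> (forall x, E x -> eta <= sg * (x - b)) ->
  exists K, forall u, K <= u -> 0 <= sg * (N 1 (sg * u) - b * N 0 (sg * u)).
Proof.
move=> sg2 mE ED muE eta0 sE.
pose K := Num.max 1 (fine (mu D) / (eta * fine (mu E))).
exists K => u Ku.
have u0 : 0 < u by apply: lt_le_trans Ku; rewrite lt_max ltr01.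
have uK : fine (mu D) / (eta * fine (mu E)) <= u.
  by apply: le_trans Ku; rewrite le_max lexx orbT.
pose w := expR (- (sg * u * b)).
have w0 : 0 < w by exact: expR_gt0.
have fE x : (w * sg * x + - (w * sg * b)) * expR (sg * u * x) =
    (sg * (x - b)) * expR (u * (sg * (x - b))).
  have -> : u * (sg * (x - b)) = - (sg * u * b) + sg * u * x by ring.
  by rewrite expRD -/w; ring.
rewrite -(pmulr_rge0 _ w0).
have -> : w * (sg * (N 1 (sg * u) - b * N 0 (sg * u))) =
    \int[mu]_(x in D) ((w * sg * x + - (w * sg * b)) * expR (sg * u * x)).
  by rewrite Rintegral_exp_affine//; ring.
apply: le_trans (_ : eta * fine (mu E) - u^-1 * fine (mu D) <= _).
  move: uK; rewrite ler_pdivrMr ?mulr_gt0// => uK.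
  by rewrite subr_ge0 ler_pdivrMl.
apply: Rintegral_ge_indic => //; first exact: continuous_exp_affine.
  by move=> x _; rewrite fE mulr_expR_ge.
move=> x Ex; rewrite fE.
have iu : 0 < u^-1 by rewrite invr_gt0.
have h := sE _ Ex.
have : 1 <= expR (u * (sg * (x - b))).
  by rewrite -expR0 ler_expR mulr_ge0// ?(ltW u0)//; lra.
move=> he; apply: (@le_trans _ _ (eta * 1)); first by lra.
by rewrite ler_pM// ltW.
Qed.

End CompactMeasure.

(** * Existence and stationarity of the MLE *)

Lemma continuous_sum_fun {R : realType} (T : topologicalType) (I : Type) (s : seq I)
    (F : I -> T -> R) : (forall i, continuous (F i)) ->
  continuous (fun x => \sum_(i <- s) F i x).
Proof.
move=> cF; elim: s => [|i s ih] x.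
  under eq_fun do rewrite big_nil; exact: cvg_cst.
under eq_fun do rewrite big_cons; apply: cvgD; [exact: cF|exact: ih].
Qed.

(** * The log-partition function when the support is bounded *)

Section LogPartition.
Context {R : realType} (mu : {measure set (measurableTypeR R) -> \bar R}).
Hypothesis Theta0 : Theta mu !=set0.
Hypothesis finA : (-oo < infsupp mu)%E.
Hypothesis ltAB : (infsupp mu < supsupp mu)%E.
Hypothesis finB : (supsupp mu < +oo)%E.
Local Notation A := (fine (infsupp mu)).
Local Notation B := (fine (supsupp mu)).
Local Notation D := (`[A, B]%classic : set (measurableTypeR R)).
Local Notation N k theta := (expmoment mu A B k theta).

Lemma infsuppE : infsupp mu = A%:E.
Proof. by rewrite fineK// fin_numElt finA (lt_trans ltAB). Qed.

Lemma supsuppE : supsupp mu = B%:E.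
Proof. by rewrite fineK// fin_numElt finB (lt_trans finA). Qed.

Let AB : A < B. Proof. by rewrite -lte_fin -infsuppE -supsuppE. Qed.

Lemma supp_sub_itvcc : supp mu `<=` D.
Proof.
move=> x sx; rewrite /= in_itv/= -!lee_fin -infsuppE -supsuppE; apply/andP; split.
  by apply: ereal_inf_lbound; exists x.
by apply: ereal_sup_ubound; exists x.
Qed.

Lemma measure_itvcc_compl : mu (~` D) = 0%E.
Proof.
apply: (negligibleP mu _).1; first by apply: measurableC; exact: measurable_itv.
apply: negligibleS (negligible_supp_compl mu); exact: subsetC supp_sub_itvcc.
Qed.

Lemma measurable_expM (E : set (measurableTypeR R)) (theta : R) :
  measurable_fun E (fun x : measurableTypeR R => (expR (theta * x))%:E).
Proof.
have ce : continuous (fun x : R => expR (theta * x)).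
  move=> x; apply: (@continuous_comp _ _ _ ( *%R theta) expR).
    by apply: cvgM; [exact: cvg_cst|exact: cvg_id].
  exact: continuous_expR.
apply/measurable_EFinP; apply: measurable_funTS.
exact: continuous_measurable_fun.
Qed.

(** One point of [Theta] is enough: on [D] its exponential is bounded below by a positive
    constant. *)
Lemma measure_itvcc_lty : (mu D < +oo)%E.
Proof.
have [theta] := Theta0; rewrite /Theta/= => th.
have mD : measurable D by exact: measurable_itv.
pose C := `|theta| * (`|A| + `|B|).
have : ((expR (- C))%:E * mu D < +oo)%E.
  apply: le_lt_trans th; rewrite -(integral_cst mu mD).
  apply: (@le_trans _ _ (\int[mu]_(x in D) (expR (theta * x))%:E)%E).
    apply: ge0_le_integral => //; [|exact: measurable_expM|].
    - by move=> x _; rewrite lee_fin expR_ge0.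
    - move=> x Dx; rewrite lee_fin ler_expR.
      have := norm_mul_itvcc_le _ _ _ _ _ (lexx `|theta|) Dx.
      by rewrite ler_norml => /andP[].
  apply: ge0_subset_integral => //; first exact: measurable_expM.
by rewrite !ltey; apply: contraNN => /eqP ->; rewrite gt0_muley// lte_fin expR_gt0.
Qed.

Lemma expmoment0E theta : (\int[mu]_x (expR (theta * x))%:E = (N 0 theta)%:E)%E.
Proof.
have mD : measurable D by exact: measurable_itv.
rewrite (ge0_negligible_integral (N := ~` D))//.
- rewrite setDE setTI setCK /expmoment.
  under [in RHS]eq_Rintegral do rewrite expr0 mul1r.
  rewrite /Rintegral fineK//; apply: integrable_fin_num => //.
  rewrite [X in integrable _ _ X](_ : _ = EFin \o fun x => (0 * x + 1) * expR (theta * x)).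
    exact/(continuous_integrable mu A B measure_itvcc_lty)/continuous_exp_affine.
  by apply/funext => x /=; rewrite mul0r add0r mul1r.
- exact: measurableC.
- exact: measurable_expM.
- exact: measure_itvcc_compl.
Qed.

Lemma ThetaT : Theta mu = setT.
Proof. by apply/seteqP; split => // theta _; rewrite /Theta/= expmoment0E ltry. Qed.

Lemma measure_itvccI_gt0 (F : set (measurableTypeR R)) : measurable F ->
  (0 < mu F)%E -> 0 < fine (mu (D `&` F)).
Proof.
move=> mF F0; have mD : measurable D by exact: measurable_itv.
apply: fine_gt0; apply/andP; split; last first.
  apply: le_lt_trans measure_itvcc_lty; apply: le_measure; rewrite ?inE//.
  exact: measurableI.
have : (mu F <= mu (~` D) + mu (D `&` F))%E.
  apply: le_trans (measureU2 _ _ _); [|exact: measurableC|exact: measurableI].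
  apply: le_measure; rewrite ?inE//.
    by apply: measurableU; [exact: measurableC|exact: measurableI].
  by move=> x Fx; have [Dx|Dx] := pselect (D x); [right|left].
by rewrite measure_itvcc_compl add0e; exact: lt_le_trans.
Qed.

(** Some point of the support exceeds [b], and the open half-line is a neighbourhood of it. *)
Lemma measure_gt_supp_gt0 b : b < B -> 0 < fine (mu (D `&` [set x | b < x])).
Proof.
move=> bB; apply: measure_itvccI_gt0.
  by apply: open_measurable; exact: open_gt.
have [_ [x sx <-]] : exists2 y, (EFin @` supp mu) y & (b%:E < y)%E.
  by apply: ereal_sup_gt; rewrite -[ereal_sup _]/(supsupp mu) supsuppE lte_fin.
by rewrite lte_fin => bx; apply: sx => //; exact: open_gt.
Qed.

Lemma measure_lt_supp_gt0 b : A < b -> 0 < fine (mu (D `&` [set x | x < b])).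
Proof.
move=> Ab; apply: measure_itvccI_gt0.
  by apply: open_measurable; exact: open_lt.
have [_ [x sx <-]] : exists2 y, (EFin @` supp mu) y & (y < b%:E)%E.
  by apply: ereal_inf_lt; rewrite -[ereal_inf _]/(infsupp mu) infsuppE lte_fin.
by rewrite lte_fin => xb; apply: sx => //; exact: open_lt.
Qed.

Lemma expmoment0_gt0 theta : 0 < N 0 theta.
Proof.
have mD : measurable D by exact: measurable_itv.
pose E : set (measurableTypeR R) := D `&` [set x | A < x].
have mE : measurable E.
  by apply: measurableI => //; apply: open_measurable; exact: open_gt.
have -> : N 0 theta = \int[mu]_(x in D) ((0 * x + 1) * expR (theta * x)).
  by rewrite Rintegral_exp_affine ?measure_itvcc_lty//; ring.
pose c := expR (- (`|theta| * (`|A| + `|B|))).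
apply: (@lt_le_trans _ _ (c * fine (mu E) - 0 * fine (mu D))).
  rewrite mul0r subr0 mulr_gt0 ?expR_gt0//; exact: measure_gt_supp_gt0.
apply: Rintegral_ge_indic => //.
- exact: measure_itvcc_lty.
- exact: continuous_exp_affine.
- by move=> x [].
- by move=> x _; rewrite oppr0 mul0r add0r mul1r expR_ge0.
- move=> x [Dx _]; rewrite subr0 mul0r add0r mul1r ler_expR.
  have := norm_mul_itvcc_le _ _ _ _ _ (lexx `|theta|) Dx.
  by rewrite ler_norml => /andP[].
Qed.

Lemma is_derive_psi (theta : R) : is_derive theta 1 (psi mu) (N 1 theta / N 0 theta).
Proof.
have -> : psi mu = @ln R \o expmoment mu A B 0.
  by apply/funext => t; rewrite /psi expmoment0E.
have d0 := is_derive_expmoment0 mu A B measure_itvcc_lty theta.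
rewrite mulrC; apply: is_derive1_comp; apply: is_derive1_ln; exact: expmoment0_gt0.
Qed.

Lemma derive1_psi (theta : R) : derive1 (psi mu) theta = N 1 theta / N 0 theta.
Proof. by rewrite derive1E; apply: (@derive_val _ _ _ _ _ _ _ (is_derive_psi theta)). Qed.

Lemma derivable_psi (theta : R) : derivable (psi mu) theta 1.
Proof. by have [] := is_derive_psi theta. Qed.

(** Turns the moment inequalities of the previous section into comparisons of the derivative of
    [psi] with [b], as [N 0 theta] is positive. *)
Lemma mul_derive1_psi_sub theta b : N 1 theta - b * N 0 theta = (derive1 (psi mu) theta - b) * N 0 theta.
Proof. by rewrite derive1_psi mulrBl divfK// gt_eqF// expmoment0_gt0. Qed.

Lemma derive1_psi_ge_near_pinfty b : b < B ->
  exists K, forall theta, K <= theta -> b <= derive1 (psi mu) theta.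
Proof.
move=> bB; have mD : measurable D by exact: measurable_itv.
(* The midpoint leaves positive mass above [b'] and a positive gap [b' - b]. *)
pose b' := (b + B) / 2.
have [||||x|K hK] := tilted_mean_limit mu A B measure_itvcc_lty 1 b (b' - b)
    (D `&` [set x | b' < x]) (mulr1 1).
- by apply: measurableI => //; apply: open_measurable; exact: open_gt.
- by move=> x [].
- apply: measure_gt_supp_gt0; rewrite /b'; lra.
- rewrite /b'; lra.
- by case=> _ /= bx; rewrite mul1r lerD2r ltW.
exists K => theta /hK; rewrite !mul1r mul_derive1_psi_sub.
by rewrite pmulr_lge0 ?expmoment0_gt0// subr_ge0.
Qed.

Lemma derive1_psi_le_near_ninfty b : A < b ->
  exists K, forall theta, theta <= - K -> derive1 (psi mu) theta <= b.
Proof.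
move=> Ab; have mD : measurable D by exact: measurable_itv.
pose b' := (b + A) / 2.
have [||||x|K hK] := tilted_mean_limit mu A B measure_itvcc_lty (- 1) b (b - b')
    (D `&` [set x | x < b']) (etrans (mulrNN 1 1) (mulr1 1)).
- by apply: measurableI => //; apply: open_measurable; exact: open_lt.
- by move=> x [].
- apply: measure_lt_supp_gt0; rewrite /b'; lra.
- rewrite /b'; lra.
- by case=> _ /= bx; rewrite mulN1r opprB lerD2l lerN2 ltW.
exists K => theta; rewrite lerNr => /hK; rewrite !mulN1r opprK mul_derive1_psi_sub.
by rewrite -mulNr pmulr_lge0 ?expmoment0_gt0// opprB subr_ge0.
Qed.

Lemma derive1_psi_bounds (M : R) : exists2 d : R, 0 < d & forall theta, `|theta| <= M ->
  A + d <= derive1 (psi mu) theta <= B - d.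
Proof.
have mD : measurable D by exact: measurable_itv.
pose b := (A + B) / 2; have [Ab bB] := midf_lt AB.
have [|||||x|d1 d10 hd1] := tilted_mean_gap mu A B measure_itvcc_lty 1 A (b - A)
    (D `&` [set x | b < x]) M.
- by apply: measurableI => //; apply: open_measurable; exact: open_gt.
- by move=> x [].
- exact: measure_gt_supp_gt0.
- by rewrite subr_gt0.
- by move=> x; rewrite /= in_itv/= mul1r subr_ge0 => /andP[].
- by case=> _ /= bx; rewrite mul1r lerD2r ltW.
have [|||||x|d2 d20 hd2] := tilted_mean_gap mu A B measure_itvcc_lty (- 1) B (B - b)
    (D `&` [set x | x < b]) M.
- by apply: measurableI => //; apply: open_measurable; exact: open_lt.
- by move=> x [].
- exact: measure_lt_supp_gt0.
- by rewrite subr_gt0.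
- by move=> x; rewrite /= in_itv/= mulN1r opprB subr_ge0 => /andP[].
- by case=> _ /= bx; rewrite mulN1r opprB lerD2l lerN2 ltW.
exists (Num.min d1 d2); first by rewrite lt_min d10.
move=> theta tM; have := hd1 _ tM; have := hd2 _ tM.
rewrite !mul_derive1_psi_sub !mulrA !ler_pM2r ?expmoment0_gt0//.
have := ge_min d1 d1 d2; have := ge_min d2 d1 d2; rewrite !lexx orbT/=.
move=> m1 m2 h1 h2; apply/andP; split; lra.
Qed.

Lemma psi_ge_linear theta b m : 0 < m ->
  m * expR (theta * b) <= N 0 theta -> theta * b + ln m <= psi mu theta.
Proof.
move=> m0 h; rewrite /psi expmoment0E//= addrC -[X in _ + X]expRK -lnM ?posrE ?expR_gt0//.
by rewrite ler_ln ?posrE ?mulr_gt0 ?expR_gt0// expmoment0_gt0.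
Qed.

Lemma expmoment0_ge theta b (E : set (measurableTypeR R)) : measurable E ->
  E `<=` D -> (forall x, E x -> theta * b <= theta * x) ->
  fine (mu E) * expR (theta * b) <= N 0 theta.
Proof.
move=> mE ED Eb; have mD : measurable D by exact: measurable_itv.
have muD := measure_itvcc_lty.
have -> : N 0 theta = \int[mu]_(x in D) ((0 * x + 1) * expR (theta * x)).
  by rewrite Rintegral_exp_affine//; ring.
rewrite mulrC -[leLHS]subr0 -[X in _ - X](mul0r (fine (mu D))).
apply: Rintegral_ge_indic => //; first exact: continuous_exp_affine.
  by move=> x _; rewrite oppr0 mul0r add0r mul1r expR_ge0.
by move=> x /Eb h; rewrite subr0 mul0r add0r mul1r ler_expR.
Qed.

(** There is mass below some [a < x] and above some [b > x]. So [psi] lies above a line of slope [b]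
    for [theta >= 0] and above one of slope [a] for [theta < 0], and [x * theta] loses to it
    linearly on both sides. *)
Lemma legendre_coercive x : A < x -> x < B ->
  exists c d : R, 0 < c /\ forall theta, x * theta - psi mu theta <= d - c * `|theta|.
Proof.
move=> Ax xB; have mD : measurable D by exact: measurable_itv.
pose a := (A + x) / 2; pose b := (x + B) / 2.
have [Aa ax] := midf_lt Ax; have [xb bB] := midf_lt xB.
rewrite -/a in Aa ax; rewrite -/b in xb bB.
pose Ea := D `&` [set y | y < a]; pose Eb := D `&` [set y | b < y].
have mEa : measurable Ea.
  by apply: measurableI => //; apply: open_measurable; exact: open_lt.
have mEb : measurable Eb.
  by apply: measurableI => //; apply: open_measurable; exact: open_gt.
have pa := measure_lt_supp_gt0 _ Aa.
have pb := measure_gt_supp_gt0 _ bB.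
exists (Num.min (x - a) (b - x)), (Num.max (- ln (fine (mu Ea))) (- ln (fine (mu Eb)))).
split; first by rewrite lt_min !subr_gt0 ax.
move=> theta.
set d := Num.max _ _; set c := Num.min _ _.
have da : - ln (fine (mu Ea)) <= d by rewrite le_max lexx.
have db : - ln (fine (mu Eb)) <= d by rewrite le_max lexx orbT.
have ca : c <= x - a by rewrite ge_min lexx.
have cb : c <= b - x by rewrite ge_min lexx orbT.
have [t0|t0] := leP 0 theta.
  have h : theta * b + ln (fine (mu Eb)) <= psi mu theta.
    apply: psi_ge_linear => //; apply: expmoment0_ge => //.
      by move=> y [].
    by move=> y [_ /= /ltW yb]; rewrite ler_wpM2l.
  rewrite ger0_norm//; nra.
have h : theta * a + ln (fine (mu Ea)) <= psi mu theta.
  apply: psi_ge_linear => //; apply: expmoment0_ge => //.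
    by move=> y [].
  by move=> y [_ /= /ltW ya]; rewrite ler_wnM2l// ltW.
rewrite ltr0_norm//; nra.
Qed.

(** * The likelihood: symmetry, stationarity and existence of a maximizer *)

Lemma admissibleT m n (alpha : 'rV[R]_m) (beta : 'rV[R]_n) :
  admissible mu alpha beta.
Proof. by move=> i j; rewrite ThetaT// interiorT. Qed.

Lemma loglikC m n (r : 'rV[R]_m) (c : 'rV[R]_n) (alpha : 'rV[R]_m) (beta : 'rV[R]_n) :
  loglik mu c r beta alpha = loglik mu r c alpha beta.
Proof.
rewrite /loglik; congr (_ - _); first by rewrite addrC.
rewrite exchange_big; apply: eq_bigr => i _; apply: eq_bigr => j _.
by rewrite addrC.
Qed.

Lemma is_MLEC m n (r : 'rV[R]_m) (c : 'rV[R]_n) (alpha : 'rV[R]_m) (beta : 'rV[R]_n) :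
  is_MLE mu r c alpha beta -> is_MLE mu c r beta alpha.
Proof.
move=> [_ mx]; split; first exact: admissibleT.
by move=> b a _; rewrite !(loglikC _ _ r); apply: mx; exact: admissibleT.
Qed.

Lemma loglik_row_shift m n (r : 'rV[R]_m) (c : 'rV[R]_n) (alpha : 'rV[R]_m)
    (beta : 'rV[R]_n) i t :
  loglik mu r c (\row_k (alpha ord0 k + (k == i)%:R * t)) beta =
  loglik mu r c alpha beta + (r ord0 i * t
    - \sum_j psi mu (alpha ord0 i + beta ord0 j + t)
    + \sum_j psi mu (alpha ord0 i + beta ord0 j)).
Proof.
rewrite /loglik; move: (psi mu) => f.
have -> : \sum_k r ord0 k * (\row_k (alpha ord0 k + (k == i)%:R * t)) ord0 k =
    \sum_k r ord0 k * alpha ord0 k + r ord0 i * t.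
  under eq_bigr do rewrite mxE mulrDr.
  rewrite big_split/= [X in _ + X](bigD1 i)//= eqxx mul1r.
  rewrite [X in _ + (_ + X)]big1 ?addr0// => k /negbTE ->.
  by rewrite mul0r mulr0.
rewrite [X in _ - X = _](bigD1 i)//= [X in _ = _ - X + _](bigD1 i)//=.
have -> : \sum_(k | k != i) \sum_j
      f ((\row_k (alpha ord0 k + (k == i)%:R * t)) ord0 k + beta ord0 j) =
    \sum_(k | k != i) \sum_j f (alpha ord0 k + beta ord0 j).
  apply: eq_bigr => k /negbTE ki; apply: eq_bigr => j _.
  by rewrite mxE ki mul0r addr0.
have -> : \sum_j f ((\row_k (alpha ord0 k + (k == i)%:R * t)) ord0 i + beta ord0 j) =
    \sum_j f (alpha ord0 i + beta ord0 j + t).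
  by apply: eq_bigr => j _; rewrite mxE eqxx mul1r addrAC.
ring.
Qed.

(** First-order condition in the single coordinate [alpha i]: up to a constant, [G] is the
    likelihood along that coordinate, and it is maximal at 0. *)
Lemma MLE_row_sum m n (r : 'rV[R]_m) (c : 'rV[R]_n) (alpha : 'rV[R]_m)
    (beta : 'rV[R]_n) : is_MLE mu r c alpha beta ->
  forall i, \sum_j derive1 (psi mu) (alpha ord0 i + beta ord0 j) = r ord0 i.
Proof.
move=> [_ mx] i.
pose G (t : R) := r ord0 i * t - \sum_j psi mu (alpha ord0 i + beta ord0 j + t).
have dG (t : R) : is_derive t 1 G
    (r ord0 i - \sum_j derive1 (psi mu) (alpha ord0 i + beta ord0 j + t)).
  have d1 j : is_derive t 1 (fun t => psi mu (alpha ord0 i + beta ord0 j + t))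
      (derive1 (psi mu) (alpha ord0 i + beta ord0 j + t)).
    set u := alpha ord0 i + beta ord0 j.
    rewrite -[derive1 _ _]mulr1; apply: (@is_derive1_comp _ (psi mu) (fun t => u + t)).
      rewrite derive1_psi//; exact: is_derive_psi.
    have -> : (fun t => u + t) = cst u + id by [].
    by apply: is_derive_eq; rewrite add0r.
  have -> : G = ( *%R (r ord0 i)) -
      \sum_j (fun t => psi mu (alpha ord0 i + beta ord0 j + t)).
    by apply/funext => x; rewrite /G fctE fct_sumE.
  apply: is_deriveB.
  have -> : *%R (r ord0 i) = r ord0 i \*: id by [].
  by apply: is_derive_eq; rewrite /GRing.scale/= mulr1.
have G0 t : G t <= G 0.
  have := mx _ beta (admissibleT _ _ (\row_k (alpha ord0 k + (k == i)%:R * t)) _).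
  rewrite loglik_row_shift gerDl /G mulr0.
  under [X in _ -> _ <= _ - X]eq_bigr do rewrite addr0.
  by rewrite -lerBrDr.
have := @derive1_at_max _ G (- 1) 1 0 _ _ _ (fun t _ => G0 t).
have in0 : (0 : R) \in `](- 1), 1[ by rewrite in_itv/= ltrN10 ltr01.
move=> /(_ _ _ in0); case.
- lra.
- by move=> t _; exact: (@ex_derive _ _ _ _ _ _ _ (dG t)).
move=> _; rewrite (@derive_val _ _ _ _ _ _ _ (dG 0)) => /eqP.
rewrite subr_eq0 => /eqP ->.
by apply: eq_bigr => j _; rewrite addr0.
Qed.

Lemma MLE_col_sum m n (r : 'rV[R]_m) (c : 'rV[R]_n) (alpha : 'rV[R]_m)
    (beta : 'rV[R]_n) : is_MLE mu r c alpha beta ->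
  forall j, \sum_i derive1 (psi mu) (alpha ord0 i + beta ord0 j) = c ord0 j.
Proof.
move=> /is_MLEC/MLE_row_sum h j; rewrite -h.
by apply: eq_bigr => i _; rewrite addrC.
Qed.

(** Writes the likelihood as a sum over cells, so that it depends only on the sums
    [alpha i + beta j] and [legendre_coercive] applies to each cell. *)
Lemma loglik_Tmargin m n (r : 'rV[R]_m) (c : 'rV[R]_n) (X : 'M[R]_(m, n))
    (alpha : 'rV[R]_m) (beta : 'rV[R]_n) : Tmargin r c X ->
  loglik mu r c alpha beta = \sum_i \sum_j
    (X i j * (alpha ord0 i + beta ord0 j) - psi mu (alpha ord0 i + beta ord0 j)).
Proof.
move=> [Xr Xc]; rewrite /loglik.
under eq_bigr do rewrite -Xr mulr_suml.
under [X in _ + X - _]eq_bigr do rewrite -Xc mulr_suml.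
rewrite [X in _ + X - _]exchange_big -big_split -sumrB /=.
apply: eq_bigr => i _; rewrite -big_split -sumrB/=.
by apply: eq_bigr => j _; rewrite mulrDr.
Qed.

Lemma MLE_exists m n (r : 'rV[R]_m.+1) (c : 'rV[R]_n.+1) (X : 'M[R]_(m.+1, n.+1)) :
  Tmargin r c X -> (forall i j, A < X i j < B) ->
  exists (alpha : 'rV[R]_m.+1) (beta : 'rV[R]_n.+1), is_MLE mu r c alpha beta.
Proof.
move=> TX XAB.
have /choice [C hC] : forall ij : 'I_m.+1 * 'I_n.+1, exists cd : R * R, 0 < cd.1 /\
    forall theta, X ij.1 ij.2 * theta - psi mu theta <= cd.2 - cd.1 * `|theta|.
  move=> [i j]; have /andP[h1 h2] := XAB i j.
  by have [a [d h]] := legendre_coercive _ h1 h2; exists (a, d).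
pose L := loglik mu r c 0 0.
(* Where the likelihood is at least its value [L] at 0, the linear losses of all cells add up to at
   most [S]. Each loss is nonnegative, so each is at most [S]; [M] then bounds all cell sums at
   once. *)
pose S := \sum_i \sum_j (C (i, j)).2 - L.
pose M := \sum_i \sum_j S / (C (i, j)).1.
have bound alpha beta i j : L <= loglik mu r c alpha beta ->
    (C (i, j)).1 * `|alpha ord0 i + beta ord0 j| <= S.
  rewrite (loglik_Tmargin _ _ _ _ _ _ _ TX) => h.
  have {h} : L <= \sum_i \sum_j ((C (i, j)).2 -
      (C (i, j)).1 * `|alpha ord0 i + beta ord0 j|).
    apply: le_trans h _; apply: ler_sum => k _; apply: ler_sum => l _.
    exact: (hC (k, l)).2.
  under eq_bigr do rewrite sumrB.
  rewrite sumrB /S.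
  set w := \sum_k \sum_l (C (k, l)).1 * _ => h.
  apply: (@le_trans _ _ w); last lra.
  have w0 k l : 0 <= (C (k, l)).1 * `|alpha ord0 k + beta ord0 l|.
    by rewrite mulr_ge0// ltW//; exact: (hC (k, l)).1.
  rewrite /w (bigD1 i)//= (bigD1 j)//= -addrA lerDl addr_ge0//.
    by apply: sumr_ge0 => l _; exact: w0.
  by apply: sumr_ge0 => k _; apply: sumr_ge0 => l _; exact: w0.
have S0 : 0 <= S.
  have := bound 0 0 ord0 ord0 (lexx _); apply: le_trans.
  by rewrite mulr_ge0// ltW//; exact: (hC (ord0, ord0)).1.
have boundM alpha beta i j : L <= loglik mu r c alpha beta ->
    `|alpha ord0 i + beta ord0 j| <= M.
  move=> /(bound _ _ i j); rewrite mulrC -ler_pdivlMr; last exact: (hC (i, j)).1.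
  move/le_trans; apply.
  have q0 k l : 0 <= S / (C (k, l)).1.
    by rewrite divr_ge0// ltW//; exact: (hC (k, l)).1.
  rewrite /M (bigD1 i)//= (bigD1 j)//= -addrA lerDl addr_ge0//.
    by apply: sumr_ge0 => l _; exact: q0.
  by apply: sumr_ge0 => k _; apply: sumr_ge0 => l _; exact: q0.
have M0 : 0 <= M by apply: le_trans (boundM 0 0 ord0 ord0 (lexx _)).
(* The radius is [2 * M] because a normalized [alpha i] is a difference of two cell sums. *)
pose K := [set v : 'rV[R]_(m.+1 + n.+1) | forall i, `[- (2 * M), 2 * M]%classic (v ord0 i)].
pose F (v : 'rV[R]_(m.+1 + n.+1)) := loglik mu r c (lsubmx v) (rsubmx v).
have [||| v vK vmax] := @EVT_max_rV R _ F K.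
- by exists 0 => i; rewrite /= mxE in_itv/= oppr_le0 mulr_ge0.
- by apply: (@rV_compact R _ (fun=> `[- (2 * M), 2 * M]%classic)) => i; exact: segment_compact.
- apply: continuous_subspaceT.
  have -> : F = fun v => \sum_i \sum_j (X i j * (v ord0 (lshift _ i) + v ord0 (rshift _ j))
      - psi mu (v ord0 (lshift _ i) + v ord0 (rshift _ j))).
    apply/funext => v; rewrite /F (loglik_Tmargin _ _ _ _ _ _ _ TX).
    by apply: eq_bigr => i _; apply: eq_bigr => j _; rewrite !mxE.
  apply: continuous_sum_fun => i; apply: continuous_sum_fun => j v.
  have cij : continuous (fun v : 'rV[R]_(m.+1 + n.+1) =>
      v ord0 (lshift _ i) + v ord0 (rshift _ j)).
    by move=> w; apply: (@cvgD _ _ _ (nbhs w) (nbhs_filter w)); exact: coord_continuous.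
  apply: (@cvgB _ _ _ (nbhs v) (nbhs_filter v)).
    by apply: (@cvgM _ _ (nbhs v) (nbhs_filter v)); [exact: cvg_cst|exact: cij].
  have cpsi : {for v ord0 (lshift _ i) + v ord0 (rshift _ j), continuous (psi mu)}.
    by apply: differentiable_continuous; apply/derivable1_diffP; exact: derivable_psi.
  exact: (cvg_comp _ _ (cij v) cpsi).
exists (lsubmx v), (rsubmx v); split; first exact: admissibleT.
move=> alpha beta _; rewrite -/(F v).
have FL : L <= F v.
  have -> : L = F 0 by rewrite /F /L !linear0.
  by apply: vmax; rewrite inE => i; rewrite /= mxE in_itv/= oppr_le0 mulr_ge0.
have [lL|/ltW lL] := leP L (loglik mu r c alpha beta); last exact: (le_trans lL FL).
(* The likelihood only depends on the sums [alpha i + beta j], so one may assume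
   [alpha 0 = 0]; the bounds on these sums then bound [alpha] and [beta]. *)
pose a := alpha ord0 ord0.
pose w : 'rV[R]_(m.+1 + n.+1) := row_mx (\row_i (alpha ord0 i - a)) (\row_j (beta ord0 j + a)).
have -> : loglik mu r c alpha beta = F w.
  rewrite /F /w row_mxKl row_mxKr !(loglik_Tmargin _ _ _ _ _ _ _ TX).
  apply: eq_bigr => i _; apply: eq_bigr => j _; rewrite !mxE.
  by rewrite addrACA addNr addr0.
apply: vmax; rewrite inE => k; rewrite /w /= in_itv/= -ler_norml mxE.
case: splitP => [i _|j _]; rewrite mxE.
  have -> : alpha ord0 i - a = alpha ord0 i + beta ord0 ord0 - (a + beta ord0 ord0) by ring.
  rewrite (le_trans (ler_normB _ _))// mulr_natl mulr2n lerD//; exact: boundM.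
rewrite addrC (le_trans (boundM _ _ ord0 j lL))//; lra.
Qed.

End LogPartition.

(** * Margins close to the boundary *)

Section ExtremalMargins.
Context {R : realType}.
Implicit Types (s t a y d e : R).

(** The quadratic has its minimum [s - u ^+ 2 <= - e] at [u = (s + t) / 2]. The fraction [k / n]
    lies strictly between [u] and [u + e], where the value is below [e ^+ 2 - e <= 0]; [e <= 1 - u]
    keeps it below 1. *)
Lemma extremal_density s t : 0 < s -> s <= t -> t < 1 -> 4 * s < (s + t) ^+ 2 ->
  exists k n : nat, [/\ (0 < k)%N, (k < n)%N &
    forall a, k%:R = a * n%:R -> a ^+ 2 - (s + t) * a + s < 0].
Proof.
move=> s0 st t1 h.
pose u := (s + t) / 2; pose e := Num.min (1 - u) (u ^+ 2 - s).
have su : s + t = 2 * u by rewrite /u; field.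
have e0 : 0 < e by rewrite lt_min /u; apply/andP; split; nra.
have e1 : e <= 1 - u by rewrite ge_min lexx.
have e2 : e <= u ^+ 2 - s by rewrite ge_min lexx orbT.
pose n := (Num.truncn (e^-1)).+1; pose k := (Num.truncn (u * n%:R)).+1.
have n0 : 0 < n%:R :> R by rewrite ltr0n.
have ne : 1 < e * n%:R.
  by have := truncnS_gt e^-1; rewrite -/n -ltr_pdivrMl// mulr1.
have u0 : 0 < u by rewrite /u; lra.
have k1 : u * n%:R < k%:R by exact: truncnS_gt.
have k2 : k%:R <= u * n%:R + 1.
  by rewrite /k -natr1 lerD2r truncn_le// mulr_ge0// ltW.
exists k, n; split => //.
  by rewrite -(ltr_nat R); nra.
move=> a ka.
have au : u < a by rewrite ka ltr_pM2r in k1.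
have ae : a < u + e by rewrite -(ltr_pM2r n0) mulrDl -ka; lra.
nra.
Qed.

(** The quadratic condition says exactly [s / a < (t - a) / (1 - a)]. Any [y] in between satisfies
    [s < a * y] and [(1 - a) * y + a < t]; the other inequalities follow. *)
Lemma extremal_level a s t : 0 < s -> t < 1 -> 0 < a -> a < 1 ->
  a ^+ 2 - (s + t) * a + s < 0 ->
  exists y, [/\ 0 < y, y < 1, s < a * y < t & s < (1 - a) * y + a < t].
Proof.
move=> s0 t1 a0 a1 h.
have a'0 : 0 < 1 - a by lra.
have : s / a < (t - a) / (1 - a).
  by rewrite ltr_pdivrMr// mulrAC ltr_pdivlMr//; nra.
move=> /midf_lt; set y := (_ + _) / 2 => -[].
rewrite ltr_pdivrMr// ltr_pdivlMr// => sy yt.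
have y0 : 0 < y by nra.
have yt' : y < t by nra.
by exists y; split => //; [lra|apply/andP; split; nra|apply/andP; split; nra].
Qed.

Lemma sum_ltn_ord n k : (k <= n)%N -> \sum_(j < n) ((j < k)%N%:R : R) = k%:R.
Proof.
move=> kn; rewrite -natr_sum -big_mkcond/= (big_ord_narrow kn)/=.
by rewrite sum1_card card_ord.
Qed.

(* Both [z] and any competitor with the same margins have the same defect; for
   [z] it is [e] per cell of the two diagonal blocks, with [e < d]. *)
Lemma extremal_margins s t d : 0 < s -> s <= t -> t < 1 -> 4 * s < (s + t) ^+ 2 ->
  0 < d -> exists n (z : 'I_n.+1 -> 'I_n.+1 -> R),
  [/\ forall i j, 0 < z i j < 1,
      forall i, s * n.+1%:R <= \sum_j z i j <= t * n.+1%:R,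
      forall j, s * n.+1%:R <= \sum_i z i j <= t * n.+1%:R &
      forall z' : 'I_n.+1 -> 'I_n.+1 -> R, (forall i j, d <= z' i j <= 1 - d) ->
        (forall i, \sum_j z' i j = \sum_j z i j) ->
        (forall j, \sum_i z' i j = \sum_i z i j) -> False].
Proof.
move=> s0 st t1 h d0; have [k [n [k0 kn ak]]] := extremal_density _ _ s0 st t1 h.
case: n kn ak => // n kn ak.
have nR : 0 < n.+1%:R :> R by rewrite ltr0n.
pose a : R := k%:R / n.+1%:R.
have aE : k%:R = a * n.+1%:R by rewrite divfK// gt_eqF.
have a0 : 0 < a by rewrite divr_gt0// ltr0n.
have a1 : a < 1 by rewrite ltr_pdivrMr// mul1r ltr_nat.
have [y [y0 y1 /andP[sy1 sy2] /andP[sy3 sy4]]] := extremal_level _ _ _ s0 t1 a0 a1 (ak _ aE).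
(* [d / 2] puts [e] below [d], [1 / 2] keeps the entries in the open unit interval, and the last two
   terms are the slack available to the row sums outside and inside the block. *)
pose e := Num.min (Num.min (d / 2) (1 / 2)) (Num.min (t - a * y) ((1 - a) * y + a - s)).
have e0 : 0 < e by rewrite !lt_min; apply/andP; split; apply/andP; split; lra.
have e1 : e <= d / 2 by rewrite !ge_min lexx.
have e2 : e <= 1 / 2 by rewrite !ge_min lexx orbT.
have e3 : e <= t - a * y by rewrite !ge_min lexx !orbT.
have e4 : e <= (1 - a) * y + a - s by rewrite !ge_min lexx !orbT.
pose x (i : 'I_n.+1) : R := (i < k)%N%:R.
have sx : \sum_i x i = a * n.+1%:R by rewrite sum_ltn_ord ?aE// ltnW.
pose z i j := x i * x j * (1 - e) + (1 - x i) * (1 - x j) * e +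
  (x i * (1 - x j) + (1 - x i) * x j) * y.
have zC i j : z i j = z j i by rewrite /z; ring.
have zr i : s * n.+1%:R <= \sum_j z i j <= t * n.+1%:R.
  have -> : \sum_j z i j = (x i * (a * (1 - e) + (1 - a) * y) +
      (1 - x i) * ((1 - a) * e + a * y)) * n.+1%:R.
    have zE j : z i j = ((1 - x i) * e + x i * y) +
        (x i * (1 - e) - (1 - x i) * e - x i * y + (1 - x i) * y) * x j.
      by rewrite /z; ring.
    under eq_bigr do rewrite zE.
    by rewrite big_split/= sumr_const card_ord -mulr_sumr sx -[_ *+ _]mulr_natl; ring.
  rewrite !ler_pM2r// /x; case: (i < k)%N => /=; apply/andP; split; nra.
exists n, z; split => //.
- move=> i j; rewrite /z /x; case: (i < k)%N; case: (j < k)%N => /=;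
    by apply/andP; split; lra.
- by move=> j; under eq_bigr do rewrite zC; exact: zr.
move=> z' z'd z'r z'c.
have E : defect _ _ x x z' = defect _ _ x x z.
  rewrite !defectE; congr (_ - _ + _).
    by apply: eq_bigr => i _; rewrite z'r.
  by apply: eq_bigr => i _; rewrite z'c.
(* A competitor gains at least [d - e] on every cell of both diagonal blocks; counting the block
   outside the first [k] indices already gives a positive amount. *)
have lt0 : 0 < (d - e) * (\sum_i (1 - x i)) * (\sum_j (1 - x j)).
  have -> : \sum_i (1 - x i) = (1 - a) * n.+1%:R.
    by rewrite sumrB sx sumr_const card_ord; ring.
  by rewrite !mulr_gt0//; lra.
have : (d - e) * (\sum_i (1 - x i)) * (\sum_j (1 - x j)) <=
    defect _ _ x x z' - defect _ _ x x z.
  rewrite /defect -sumrB -mulrA mulr_suml mulr_sumr; apply: ler_sum => i _.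
  rewrite -sumrB mulrA mulr_sumr; apply: ler_sum => j _.
  have := z'd i j; rewrite /z /x.
  by case: (i < k)%N; case: (j < k)%N => /= /andP[? ?]; lra.
by rewrite E subrr leNgt lt0.
Qed.

End ExtremalMargins.

(** * Rescaling to the unit interval and the two implications *)

Theorem theorem1p20 (R : realType)
    (mu : {sigma_finite_measure set (measurableTypeR R) -> \bar R})
    (Theta_nonempty : Theta mu !=set0)
    (Theta_not_singleton : ~ exists theta : R, Theta mu = [set theta])
    (A_finite : (-oo < infsupp mu)%E)
    (A_lt_B : (infsupp mu < supsupp mu)%E)
    (B_finite : (supsupp mu < +oo)%E)
    (s t : R)
    (hs : (infsupp mu < s%:E < supsupp mu)%E)
    (ht : (infsupp mu < t%:E < supsupp mu)%E)
    (hst : s <= t) :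
  let A := fine (infsupp mu) in
  let B := fine (supsupp mu) in
  ((s + t - 2 * A) ^+ 2 < 4 * (B - A) * (s - A) -> Omega mu (s, t)) /\
  ((s + t - 2 * A) ^+ 2 > 4 * (B - A) * (s - A) -> ~ Omega mu (s, t)).
Proof.
move=> A B.
have AE : infsupp mu = A%:E := infsuppE mu A_finite A_lt_B B_finite.
have BE : supsupp mu = B%:E := supsuppE mu A_finite A_lt_B B_finite.
have := hs; rewrite AE BE !lte_fin => /andP[As sB].
have := ht; rewrite AE BE !lte_fin => /andP[At tB].
pose W := B - A; have W0 : 0 < W by rewrite /W; lra.
(* The affine map sending [A], [B] to 0, 1. Both sides of the condition are [W ^+ 2] times their
   rescaled forms, so it becomes a comparison of [(s' + t') ^+ 2] with [4 * s']. *)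
pose s' := (s - A) / W; pose t' := (t - A) / W.
have sE : s = A + W * s' by rewrite /s' mulrC divfK ?gt_eqF// addrC subrK.
have tE : t = A + W * t' by rewrite /t' mulrC divfK ?gt_eqF// addrC subrK.
have s'0 : 0 < s' by rewrite divr_gt0// subr_gt0.
have t'1 : t' < 1 by rewrite ltr_pdivrMr// mul1r /W; lra.
have st' : s' <= t' by rewrite ler_pM2r ?invr_gt0// lerD2r.
have L : (s + t - 2 * A) ^+ 2 = W ^+ 2 * (s' + t') ^+ 2 by rewrite sE tE; ring.
have Rr : 4 * (B - A) * (s - A) = W ^+ 2 * (4 * s') by rewrite -/W sE; ring.
have W2 : 0 < W ^+ 2 by rewrite exprn_gt0.
rewrite L Rr !(ltr_pM2l W2).
pose phi (x : R) := (derive1 (psi mu) x - A) / W.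
have phiE x : derive1 (psi mu) x = A + W * phi x.
  by rewrite /phi mulrC divfK ?gt_eqF// addrC subrK.
have sum_phi n (f : 'I_n -> R) :
    \sum_i derive1 (psi mu) (f i) = A * n%:R + W * \sum_i phi (f i).
  under eq_bigr do rewrite phiE.
  by rewrite big_split/= sumr_const card_ord -mulr_sumr -[_ *+ _]mulr_natr.
split=> [h|h].
- have phi01 x : 0 <= phi x <= 1.
    have [d d0 /(_ x (lexx _))] :=
      derive1_psi_bounds mu Theta_nonempty A_finite A_lt_B B_finite `|x|.
    rewrite -/A -/B /phi ler_pdivrMr// mul1r => /andP[h1 h2].
    rewrite divr_ge0 ?(ltW W0)//= /W; lra.
  have lim0 e : 0 < e -> exists K, forall x : R, x <= - K -> phi x <= e.
    move=> e0; have [|K hK] := derive1_psi_le_near_ninfty mu Theta_nonempty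
        A_finite A_lt_B B_finite (A + W * e); first by rewrite ltrDl mulr_gt0.
    by exists K => x /hK; rewrite phiE lerD2l ler_pM2l.
  have lim1 e : 0 < e -> exists K, forall x : R, K <= x -> 1 - e <= phi x.
    move=> e0; have [|K hK] := derive1_psi_ge_near_pinfty mu Theta_nonempty
        A_finite A_lt_B B_finite (A + W * (1 - e)).
      have : 0 < W * e by exact: mulr_gt0.
      by rewrite -/A -/B /W; lra.
    by exists K => x /hK; rewrite phiE lerD2l ler_pM2l.
  have [M hM] := additive_bound phi s' t' lim0 lim1 phi01 s'0 t'1 h.
  have [d d0 hd] := derive1_psi_bounds mu Theta_nonempty A_finite A_lt_B B_finite M.
  (* With [delta^-1 >= C] the truncations at [- delta^-1] and [delta^-1] lie outside the interval
     from [A] to [B]; only [delta <= d] then matters. *)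
  pose C := 1 + `|A| + `|B|.
  have C0 : 0 < C by rewrite /C -addrA ltr_pwDl// addr_ge0.
  pose delta := Num.min d C^-1.
  have delta0 : 0 < delta by rewrite lt_min d0 invr_gt0.
  have dd : delta <= d by rewrite ge_min lexx.
  have dC : C <= delta^-1.
    by rewrite -[C]invrK lef_pV2 ?posrE ?invr_gt0// ge_min lexx orbT.
  split => //; exists delta; split => //.
  move=> [//|m] [//|n] _ _ r c [X [TX XAB]] hr hc.
  have [|alpha [beta mle]] := MLE_exists mu Theta_nonempty A_finite A_lt_B B_finite
      _ _ _ _ X TX.
    by move=> i j; have := XAB i j; rewrite AE BE !lte_fin.
  exists alpha, beta; split => // i j.
  (* Stationarity identifies the margins with sums of [phi], so the uniform bound [M] applies. *)
  have ab : `|alpha ord0 i + beta ord0 j| <= M.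
    apply: (hM _ _ (fun i => alpha ord0 i) (fun j => beta ord0 j)).
    + move=> k; have := hr k.
      rewrite -(MLE_row_sum mu Theta_nonempty A_finite A_lt_B B_finite _ _ _ _ _ _ mle).
      rewrite sum_phi ler_pdivlMr ?ltr0n// ler_pdivrMr ?ltr0n//= sE tE.
      set N := n.+1%:R; set S := \sum_j _ => /andP[h1 h2].
      by rewrite -![_ * N <= S](ler_pM2l W0) -[S <= _](ler_pM2l W0); apply/andP; split; lra.
    + move=> k; have := hc k.
      rewrite -(MLE_col_sum mu Theta_nonempty A_finite A_lt_B B_finite _ _ _ _ _ _ mle).
      rewrite sum_phi ler_pdivlMr ?ltr0n// ler_pdivrMr ?ltr0n//= sE tE.
      set N := m.+1%:R; set S := \sum_j _ => /andP[h1 h2].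
      by rewrite -![_ * N <= S](ler_pM2l W0) -[S <= _](ler_pM2l W0); apply/andP; split; lra.
  have := hd _ ab; rewrite -/A -/B => /andP[h1 h2].
  have nA := ler_norm (- A); have nB := ler_norm B.
  have A0 := normr_ge0 A; have B0 := normr_ge0 B; rewrite normrN in nA.
  rewrite /A_ /B_ AE BE -EFinD -EFinB ge_max le_min !lee_fin.
  rewrite /C in dC.
  by apply/andP; split; apply/andP; split; lra.
- case=> _ _ _ /= [delta [delta0 htame]].
  (* In rescaled form, [delta]-tameness puts [phi] between [delta / W] and [1 - delta / W]. *)
  have d'0 : 0 < delta / W by rewrite divr_gt0.
  have [n [z [z01 zr zc zF]]] := extremal_margins _ _ _ s'0 st' t'1 h d'0.
  pose X : 'M[R]_(n.+1, n.+1) := \matrix_(i, j) (A + W * z i j).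
  pose r : 'rV[R]_n.+1 := \row_i \sum_j X i j.
  pose c : 'rV[R]_n.+1 := \row_j \sum_i X i j.
  have rE i : r ord0 i = A * n.+1%:R + W * \sum_j z i j.
    rewrite mxE; under eq_bigr do rewrite mxE.
    by rewrite big_split/= sumr_const card_ord -mulr_sumr -[_ *+ _]mulr_natr.
  have cE j : c ord0 j = A * n.+1%:R + W * \sum_i z i j.
    rewrite mxE; under eq_bigr do rewrite mxE.
    by rewrite big_split/= sumr_const card_ord -mulr_sumr -[_ *+ _]mulr_natr.
  have [|i|j|alpha [beta [mle hab]]] := htame n.+1 n.+1 isT isT r c.
  + exists X; split; first by split=> k; rewrite mxE.
    move=> i j; have /andP[z0 z1] := z01 i j.
    by rewrite AE BE !lte_fin mxE; apply/andP; split; rewrite /W in W0 *; nra.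
  + have /andP[h1 h2] := zr i.
    rewrite ler_pdivlMr ?ltr0n// ler_pdivrMr ?ltr0n// rE sE tE.
    by rewrite -(ler_pM2l W0) in h1; rewrite -(ler_pM2l W0) in h2; apply/andP; split; lra.
  + have /andP[h1 h2] := zc j.
    rewrite ler_pdivlMr ?ltr0n// ler_pdivrMr ?ltr0n// cE sE tE.
    by rewrite -(ler_pM2l W0) in h1; rewrite -(ler_pM2l W0) in h2; apply/andP; split; lra.
  (* The tilted means at the tame MLE form the competitor with the same margins that
     [extremal_margins] excludes. *)
  apply: (zF (fun i j => phi (alpha ord0 i + beta ord0 j))).
  + move=> i j; have := hab i j.
    rewrite /A_ /B_ AE BE -EFinD -EFinB ge_max le_min !lee_fin phiE.
    move=> /andP[/andP[h1 _] /andP[h2 _]].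
    have dW : W * (delta / W) = delta by rewrite mulrC divfK ?gt_eqF.
    have WE : B = A + W by rewrite /W addrC subrK.
    apply/andP; split; first by rewrite -(ler_pM2l W0) dW; lra.
    by rewrite -(ler_pM2l W0) mulrBr dW; lra.
  + move=> i; apply: (mulfI (lt0r_neq0 W0)); apply: (addrI (A * n.+1%:R)).
    rewrite -rE -sum_phi.
    exact: (MLE_row_sum mu Theta_nonempty A_finite A_lt_B B_finite _ _ _ _ _ _ mle).
  + move=> j; apply: (mulfI (lt0r_neq0 W0)); apply: (addrI (A * n.+1%:R)).
    rewrite -cE -sum_phi.
    exact: (MLE_col_sum mu Theta_nonempty A_finite A_lt_B B_finite _ _ _ _ _ _ mle).
Qed.
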